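(* Let $\mathcal{G}$ be a graph with $N$ vertices, and suppose that $\mathcal{G}$ is isomorphic to the $G$-join $G(K_{n_y}: y\in V(G))$, where $G$ is a complete multipartite graph (with at least two parts) and, for each $y\in V(G)$, $K_{n_y}$ is a complete graph on $n_y\ge 1$ vertices. Let $L(\mathcal{G})$ be the Laplacian matrix of $\mathcal{G}$. Then there exists a basis $\mathcal{B}$ of $\mathbb{R}^N$ consisting of eigenvectors of $L(\mathcal{G})$ such that every $f\in\mathcal{B}$ whose eigenvalue $\lambda$ satisfies $\lambda\neq 0$ and is not the largest eigenvalue of $L(\mathcal{G})$ has $\mathcal{D}(f)=2$.
   Context: All graphs are finite, simple and undirected. The Laplacian matrix of a graph is $L=D-A$, where $A$ is the adjacency matrix and $D$ the diagonal matrix of vertex degrees. $G$-join: given a graph $G$ and a family of graphs $(G_y)_{y\in V(G)}$, the $G$-join $G(G_y: y\in V(G))$ has vertex set $\{(x,y): y\in V(G),\ x\in V(G_y)\}$, and two vertices $(x,y)$, $(x',y')$ are adjacent iff either $[y,y']\in E(G)$, or $y=y'$ and $[x,x']\in E(G_y)$. A complete multipartite graph is a graph whose vertex set is partitioned into $s\ge 2$ nonempty independent sets (parts), with any two vertices in different parts adjacent. Strong nodal domains: for a vector $g$ on $V(G)$ with no zero entry, a strong nodal domain of $g$ is a maximal connected subgraph $H$ of $G$ such that $g(i)g(j)>0$ for all $i,j\in V(H)$; equivalently, a connected component of the subgraph induced on $\{g>0\}$ or on $\{g<0\}$. Number of nodal decomposition $\mathcal{D}(f)$: for an eigenvector $f$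 of $L(G)$, $\mathcal{D}(f)$ is the minimum, over all vectors $g$ with $g(v)=f(v)$ whenever $f(v)\ne 0$ and $g(v)\in\{-1,1\}$ whenever $f(v)=0$, of the number of strong nodal domains of $g$. *)

(* Defs.v *)
From mathcomp Require Import all_boot all_order all_algebra.
From mathcomp Require Import reals.

Set Implicit Arguments.
Unset Strict Implicit.
Unset Printing Implicit Defensive.

Import Order.TTheory GRing.Theory Num.Theory.
Local Open Scope ring_scope.

Record sgraph := SGraph {
  vertex :> finType;
  adj : rel vertex;
  adj_sym : symmetric adj;
  adj_irr : irreflexive adj }.

Definition graph_iso (G H : sgraph) : Prop :=
  exists2 f : G -> H, bijective f & {mono f : x y / adj x y}.

Section CompleteGraph.
Variable n : nat.

Definition complete_adj : rel 'I_n := fun i j => i != j.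

Lemma complete_adj_sym : symmetric complete_adj.
Proof. by move=> i j; rewrite /complete_adj eq_sym. Qed.

Lemma complete_adj_irr : irreflexive complete_adj.
Proof. by move=> i; rewrite /complete_adj eqxx. Qed.

Definition complete_graph : sgraph := SGraph complete_adj_sym complete_adj_irr.

End CompleteGraph.

Section Join.
Variables (G : sgraph) (F : G -> sgraph).

(* The vertex (x, y), with y in V(G) and x in V(F y), is [Tagged _ x] with
   tag y; [tagged_as u v] is v transported to the fibre of u when the tags
   agree. *)
Definition join_adj : rel {y : G & F y} := fun u v =>
  adj (tag u) (tag v) ||
  (tag u == tag v) && adj (tagged u) (tagged_as u v).

Lemma tagged_as_fibre (y : G) (a b : F y) :
  tagged_as (existT (fun y => F y : Type) y a) (existT _ y b) = b.
Proof. exact: (@tagged_asE _ (fun y => F y : Type) (existT _ y a) b). Qed.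

Lemma join_adj_sym : symmetric join_adj.
Proof.
case=> [y x] [y' x']; rewrite /join_adj /= adj_sym; congr (_ || _).
rewrite eq_sym; case: (eqVneq y' y) => //= eq_y.
by case: y / eq_y x => x; rewrite !tagged_as_fibre adj_sym.
Qed.

Lemma join_adj_irr : irreflexive join_adj.
Proof.
by case=> y x; rewrite /join_adj /= tagged_as_fibre !adj_irr andbF.
Qed.

Definition graph_join : sgraph := SGraph join_adj_sym join_adj_irr.

End Join.

(* [partition] includes the nonemptiness of the parts. *)
Definition complete_multipartite (G : sgraph) : Prop :=
  exists P : {set {set G}},
    [/\ partition P [set: G],
        (2 <= #|P|)%N,
        forall A, A \in P -> {in A &, forall x y, ~~ adj x y} &
        forall A B, A \in P -> B \in P -> A != B ->
          {in A & B, forall x y, adj x y}].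

Section Laplacian.
Variables (R : nzRingType) (G : sgraph).

Definition degree (v : G) : nat := #|[set w | adj v w]|.

Definition adjmx : 'M[R]_#|G| :=
  \matrix_(i, j) (adj (enum_val i) (enum_val j))%:R.

Definition degmx : 'M[R]_#|G| := diag_mx (\row_i (degree (enum_val i))%:R).

Definition laplacian : 'M[R]_#|G| := degmx - adjmx.

Definition value_at (f : 'rV[R]_#|G|) (v : G) : R := f 0 (enum_rank v).

End Laplacian.

(* Row-vector convention, as for MathComp's [eigenvalue] and [eigenspace]; it is
   immaterial for Laplacians, which are symmetric. *)
Definition is_eigenvector (K : fieldType) n (A : 'M[K]_n) (a : K)
    (f : 'rV[K]_n) : Prop :=
  f != 0 /\ f *m A = a *: f.

Definition is_largest_eigenvalue (K : realFieldType) n (A : 'M[K]_n) (a : K) :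
    Prop :=
  eigenvalue A a /\ (forall b, eigenvalue A b -> b <= a).

Section NodalDomains.
Variables (R : realFieldType) (G : sgraph).

Definition connected_set (S : {set G}) : bool :=
  (S != set0) &&
  [forall x in S, forall y in S,
     connect [rel u v : G | [&& u \in S, v \in S & adj u v]] x y].

(* A maximal connected subgraph on which g has constant sign is induced, hence
   is identified with its vertex set. *)
Definition strong_nodal_domain (g : G -> R) (S : {set G}) : bool :=
  maxset [pred H : {set G} | connected_set H &&
            [forall i in H, forall j in H, 0 < g i * g j]] S.

Definition num_strong_nodal_domains (g : G -> R) : nat :=
  #|[set S | strong_nodal_domain g S]|.

Definition zero_completion (f g : G -> R) : Prop :=
  forall v, if f v == 0 then g v = 1 \/ g v = -1 else g v = f v.

(* The number of nodal decomposition of f is d. *)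
Definition nodal_decomposition_is (f : G -> R) (d : nat) : Prop :=
  (exists2 g, zero_completion f g & num_strong_nodal_domains g = d) /\
  (forall g, zero_completion f g -> (d <= num_strong_nodal_domains g)%N).

End NodalDomains.

(* Main.v *)
Require Import Defs.
From mathcomp Require Import all_boot all_order all_algebra.
From mathcomp Require Import reals.

Local Open Scope ring_scope.

Import Order.TTheory GRing.Theory Num.Theory.

Set Implicit Arguments.
Unset Strict Implicit.
Unset Printing Implicit Defensive.

(** Call clique of a vertex of the join the copy of some [K_(n y)] containing
    it, and part the union of the cliques over one part of the multipartite
    graph.  Equality, same clique, same part and the all-true relation form a
    chain of coarser and coarser equivalences, and two distinct vertices are
    adjacent iff they lie in one clique or in different parts.  Hence the
    Laplacian is [L_c - L_p + L_1], where [L_k f v] sums [f v - f w] over the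
    vertices [w] that are [k]-equivalent to [v] ([laplacian_fibre_lap]).

    For two consecutive equivalences [l], [m] of the chain, take the difference
    [f] of the uniform averages over two [l]-classes in the same [m]-class.  It
    is constant on the classes of every equivalence at most as coarse as [l],
    whose operator therefore kills it; and its support lies in a single class
    of each equivalence [k] at least as coarse as [m], where its values sum to
    zero, so that [L_k] multiplies it by the size of that class.  Thus [f] is
    an eigenvector.  With [N] the number of vertices, the eigenvalue is
    [#clique - #part + N] for two vertices of a clique, [N - #part] for two
    cliques of a part, and [N] for two parts.  Together with the constants
    these differences span the space, because an average over an [m]-class is
    the average of the averages over the [l]-classes of its points
    ([fibre_avg_trans]).  They are far from free, but a basis can be extracted
    from any spanning family.

    No Laplacian eigenvalue exceeds [N] ([laplacian_eigenvalue_le]), so the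
    differences of parts belong to the largest eigenvalue.  The remaining
    nonconstant vectors are negative only inside one clique, which is
    connected, and nonzero only inside one part.  Give the value 1 to their
    zeros: the set of nonnegative vertices then contains all other parts and
    some vertex of the part at hand, so it is connected too, and there are
    exactly two nodal domains ([one_clique_nodal]). *)

(** * Extracting a basis from a spanning family *)

Lemma basis_sub_span (K : fieldType) (V : vectType K) (X : seq V) :
  exists2 Y : seq V, {subset Y <= X} & basis_of <<X>>%VS Y.
Proof.
elim: X => [|v X [Y sYX /andP[/eqP spanY freeY]]].
  by exists [::] => //; rewrite basisEdim span_nil sub0v dimv0.
have [vX | vX] := boolP (v \in <<X>>%VS).
  exists Y; first by move=> w /sYX wX; rewrite inE wX orbT.
  have vXX : (<[v]> + <<X>> = <<X>>)%VS by apply/addv_idPr; rewrite -memvE.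
  by rewrite /basis_of span_cons vXX spanY eqxx.
exists (v :: Y).
  by move=> w; rewrite !inE => /orP[-> //| /sYX ->]; rewrite orbT.
by rewrite /basis_of !span_cons spanY eqxx free_cons spanY vX.
Qed.

(** * The Laplacian as an operator on functions *)

Section LaplacianAction.
Variables (R : realFieldType) (G : sgraph).
Implicit Types f : 'rV[R]_#|G|.

Definition row_of (h : G -> R) : 'rV[R]_#|G| := \row_i h (enum_val i).

Lemma value_at_row_of h v : value_at (row_of h) v = h v.
Proof. by rewrite /value_at mxE enum_rankK. Qed.

Lemma value_at_inj f1 f2 : value_at f1 =1 value_at f2 -> f1 = f2.
Proof.
move=> e; apply/rowP => i; have := e (enum_val i).
by rewrite /value_at enum_valK.
Qed.

Lemma value_at_laplacian f v :
  value_at (f *m laplacian R G) v =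
  \sum_(w | adj v w) (value_at f v - value_at f w).
Proof.
rewrite /laplacian mulmxBr /value_at mxE [in X in _ + X]mxE.
rewrite /degmx mul_mx_diag !mxE enum_rankK big_split /= sumr_const sumrN.
rewrite /degree cardsE mulr_natr; congr (_ - _).
rewrite (reindex_onto (@enum_rank G) enum_val) /=; last first.
  by move=> i _; rewrite enum_valK.
rewrite [RHS]big_mkcond; apply: eq_big => [w|w _].
  by rewrite enum_rankK eqxx.
by rewrite mxE !enum_rankK adj_sym; case: adj; rewrite ?mulr1 ?mulr0.
Qed.

Lemma is_eigenvectorP a f :
  is_eigenvector (laplacian R G) a f <->
  f != 0 /\ forall v, \sum_(w | adj v w) (value_at f v - value_at f w)
                        = a * value_at f v.
Proof.
split=> -[f0 e]; split=> //.
  by move=> v; rewrite -value_at_laplacian e /value_at mxE.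
by apply: value_at_inj => v; rewrite value_at_laplacian e /value_at mxE.
Qed.

Lemma eigenvector_value_inj a b f :
  is_eigenvector (laplacian R G) a f -> is_eigenvector (laplacian R G) b f ->
  a = b.
Proof.
move=> [f0 ea] [_ eb]; have /eqP := ea; rewrite eb -subr_eq0 -scalerBl.
by rewrite scaler_eq0 (negPf f0) orbF subr_eq0 => /eqP.
Qed.

(** The coefficients of [f *m L] are sums of differences over the edges, each
    edge being met once in each direction; so they add up to zero. *)
Lemma eigenvector_sum0 a f :
  is_eigenvector (laplacian R G) a f -> a != 0 -> \sum_v value_at f v = 0.
Proof.
move=> /is_eigenvectorP[_ e] a0; apply: (mulfI a0); rewrite mulr0 mulr_sumr.
under eq_bigr => v _ do rewrite -e big_split /= sumrN.
rewrite big_split /= sumrN.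
rewrite [X in _ - X](exchange_big_dep predT) //=.
by under [X in _ - X]eq_bigr => v _ do under eq_bigl => w do rewrite adj_sym;
  rewrite subrr.
Qed.

(** For an eigenvector [f] of sum zero, [(#|G| - a) * f v] is the sum of
    [f v - f w] over the non-neighbours [w] of [v]: it is the Laplacian of the
    complementary graph.  At a vertex where [`|f v|] is maximal, all these
    differences vanish or have the sign of [f v]. *)
Lemma laplacian_eigenvalue_le a :
  eigenvalue (laplacian R G) a -> a <= #|G|%:R.
Proof.
move=> /eigenvalueP[f ef f0].
have [a_le0|a_gt0] := leP a 0; first exact: le_trans a_le0 (ler0n _ _).
have eig : is_eigenvector (laplacian R G) a f by [].
have sum0 := eigenvector_sum0 eig (lt0r_neq0 a_gt0).
have [v0 fv0] : exists v, value_at f v != 0.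
  apply/existsP; apply: contraNT f0; rewrite negb_exists => /forallP h.
  apply/eqP/value_at_inj => v; rewrite [RHS]mxE; apply/eqP.
  by rewrite -[_ == _]negbK h.
have [v _ vmax] := @arg_maxP _ _ _ v0 predT (fun v => `|value_at f v|) isT.
have fv : value_at f v != 0.
  by rewrite -normr_gt0 (lt_le_trans _ (vmax v0 isT)) ?normr_gt0.
have eN : \sum_w (value_at f v - value_at f w) = #|G|%:R * value_at f v.
  by rewrite big_split /= sumrN sum0 subr0 sumr_const mulr_natl.
have [_ /(_ v) ea] := (is_eigenvectorP a f).1 eig.
rewrite -subr_ge0 -(pmulr_lge0 (x := value_at f v ^+ 2)); last first.
  by rewrite lt_def sqr_ge0 sqrf_eq0 fv.
rewrite expr2 mulrA mulrBl -ea -eN (bigID (adj v)) /= addrAC subrr add0r.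
rewrite mulr_suml sumr_ge0 // => w _; rewrite mulrBl subr_ge0.
apply: le_trans (ler_norm _) _; rewrite normrM -expr2.
rewrite -[leRHS]real_normK ?num_real // expr2 ler_wpM2r //; exact: vmax.
Qed.

End LaplacianAction.

(** * Counting strong nodal domains *)

Section NodalDomainCount.
Variables (R : realFieldType) (G : sgraph).
Implicit Types (g : G -> R) (S : {set G}).

Lemma connected_set1 (x : G) : connected_set [set x].
Proof.
apply/andP; split; first by apply/set0Pn; exists x; rewrite inE.
apply/forall_inP => a /set1P->; apply/forall_inP => b /set1P->.
exact: connect0.
Qed.

(** A positive and a negative vertex each generate a domain, by extending the
    singleton to a maximal set, and no domain contains both. *)
Lemma num_strong_nodal_domains_ge2 g u v :
  0 < g u -> g v < 0 -> (2 <= num_strong_nodal_domains g)%N.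
Proof.
move=> gu gv.
have dom x : g x != 0 -> exists2 S, strong_nodal_domain g S & x \in S.
  move=> gx.
  have [|S maxS sxS] := @maxset_exists _
    [pred H : {set G} | connected_set H &&
            [forall i in H, forall j in H, 0 < g i * g j]] [set x].
    rewrite /= connected_set1; apply/forall_inP => a /set1P->.
    apply/forall_inP => b /set1P->.
    by rewrite -expr2 lt_def sqrf_eq0 gx sqr_ge0.
  by exists S => //; rewrite -sub1set.
have [S domS uS] := dom u (lt0r_neq0 gu).
have [T domT vT] := dom v (ltr0_neq0 gv).
have neqST : S != T.
  apply: contraTneq gv => eST; have := maxsetp domS => /andP[_ /forall_inP].
  move=> /(_ u uS)/forall_inP/(_ v); rewrite eST => /(_ vT).
  by rewrite pmulr_rgt0 // -leNgt => /ltW.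
have <- : #|[set S; T]| = 2%N by rewrite cards2 neqST.
apply: subset_leq_card.
by apply/subsetP => U /set2P[]->; rewrite inE.
Qed.

Lemma num_strong_nodal_domains_le2 g :
  (forall x, g x != 0) ->
  connected_set [set x | 0 < g x] -> connected_set [set x | g x < 0] ->
  (num_strong_nodal_domains g <= 2)%N.
Proof.
move=> g0 conP conN.
apply: (@leq_trans #|[set [set x | 0 < g x]; [set x | g x < 0]]|); last first.
  by rewrite cards2; case: (_ != _).
apply: subset_leq_card; apply/subsetP => S; rewrite inE => /maxsetP[].
move=> /andP[/andP[/set0Pn[x xS] _] /forall_inP sgn] maxS; apply/set2P.
have sgnx y : y \in S -> 0 < g x * g y by move/forall_inP: (sgn x xS); apply.
have [gx|gx|/eqP gx] := ltgtP (g x) 0; last by have := g0 x; rewrite gx.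
- right; rewrite (maxS [set x | g x < 0]) //.
    rewrite /= conN; apply/forall_inP => a; rewrite inE => ga.
    by apply/forall_inP => b; rewrite inE => gb; rewrite nmulr_rgt0.
  by apply/subsetP => y /sgnx; rewrite inE nmulr_rgt0.
- left; rewrite (maxS [set x | 0 < g x]) //.
    rewrite /= conP; apply/forall_inP => a; rewrite inE => ga.
    by apply/forall_inP => b; rewrite inE => gb; rewrite pmulr_rgt0.
  by apply/subsetP => y /sgnx; rewrite inE pmulr_rgt0.
Qed.

(** The minimum is attained by giving the value 1 to all the zeros of [f]. *)
Lemma nodal_decomposition_eq2 (f : G -> R) u v :
  0 < f u -> f v < 0 ->
  connected_set [set x | 0 <= f x] -> connected_set [set x | f x < 0] ->
  nodal_decomposition_is f 2.
Proof.
move=> fu fv conP conN.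
have ge2 g : zero_completion f g -> (2 <= num_strong_nodal_domains g)%N.
  move=> fg; apply: (@num_strong_nodal_domains_ge2 g u v).
    by have := fg u; rewrite gt_eqF // => ->.
  by have := fg v; rewrite lt_eqF // => ->.
split=> //; pose g x := if f x == 0 then 1 else f x.
have fg : zero_completion f g.
  by move=> x; rewrite /g; case: eqP => [_|_]; [left|].
exists g => //; apply/eqP; rewrite eqn_leq ge2 // andbT.
apply: num_strong_nodal_domains_le2 => [x||].
- by rewrite /g; case: ifPn => // _; exact: oner_neq0.
- suff -> : [set x | 0 < g x] = [set x | 0 <= f x] by [].
  apply/setP=> x; rewrite !inE /g.
  by case: (ltgtP (f x) 0) => [/lt_gtF->|->|_] //; rewrite ltr01.
- suff -> : [set x | g x < 0] = [set x | f x < 0] by [].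
  apply/setP=> x; rewrite !inE /g.
  by case: (ltgtP (f x) 0) => [->|/lt_gtF->|_] //; rewrite ltr10.
Qed.

End NodalDomainCount.

(** * Averages over the classes of a labelling *)

Section FibreAverages.
Variables (R : realFieldType) (G : sgraph).
Implicit Types f : 'rV[R]_#|G|.

(** An equivalence relation on vertices is represented by a labelling, whose
    fibres are its classes; [refines l m] then says that the classes of [m]
    are unions of classes of [l]. *)
Definition fibre (T : eqType) (l : G -> T) (v : G) : {set G} :=
  [set w | l w == l v].

Definition refines (T U : Type) (l : G -> T) (m : G -> U) :=
  forall x y, l x = l y -> m x = m y.

Definition fibre_avg (T : eqType) (l : G -> T) (v : G) : 'rV[R]_#|G| :=
  row_of (fun w => (l w == l v)%:R / #|fibre l v|%:R).

(** The Laplacian of the disjoint union of the complete graphs on the fibres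
    of [l]. *)
Definition fibre_lap (T : eqType) (l : G -> T) f (v : G) : R :=
  \sum_(w | l w == l v) (value_at f v - value_at f w).

Definition fibre_diffs (T U : eqType) (l : G -> T) (m : G -> U) :
    seq 'rV[R]_#|G| :=
  [seq fibre_avg l uv.1 - fibre_avg l uv.2 |
     uv <- enum {: G * G} & m uv.1 == m uv.2].

Lemma fibre_diffsP (T U : eqType) (l : G -> T) (m : G -> U) f :
  reflect (exists u v, m u = m v /\ f = fibre_avg l u - fibre_avg l v)
          (f \in fibre_diffs l m).
Proof.
apply: (iffP mapP) => [[[u v]]|[u [v [muv ->]]]].
  by rewrite mem_filter => /andP[/eqP muv _] ->; exists u, v.
by exists (u, v); rewrite // mem_filter /= muv eqxx mem_enum.
Qed.

Lemma fibre_card_neq0 (T : eqType) (l : G -> T) v : #|fibre l v|%:R != 0 :> R.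
Proof. by rewrite pnatr_eq0 -lt0n; apply/card_gt0P; exists v; rewrite inE. Qed.

Lemma value_at_fibre_avg (T : eqType) (l : G -> T) v w :
  value_at (fibre_avg l v) w = (l w == l v)%:R / #|fibre l v|%:R.
Proof. exact: value_at_row_of. Qed.

Lemma value_atB f1 f2 v :
  value_at (f1 - f2) v = value_at f1 v - value_at f2 v.
Proof. by rewrite /value_at !mxE. Qed.

Lemma eq_fibre_avg (T : eqType) (l : G -> T) u v :
  l u = l v -> fibre_avg l u = fibre_avg l v.
Proof.
by move=> luv; apply: value_at_inj => w; rewrite !value_at_fibre_avg /fibre luv.
Qed.

Lemma fibre_sum_avg (T U : eqType) (l : G -> T) (m : G -> U) u v :
  refines l m ->
  \sum_(w | m w == m v) value_at (fibre_avg l u) w = (m u == m v)%:R.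
Proof.
move=> lm; under eq_bigr => w _ do rewrite value_at_fibre_avg.
have [muv|muv] := eqVneq (m u) (m v); last first.
  apply: big1 => w /eqP mw; case: eqP => [/lm mwu|_]; last by rewrite mul0r.
  by rewrite -mwu mw eqxx in muv.
rewrite (bigID (fun w => l w == l u)) /= [X in _ + X]big1 ?addr0; last first.
  by move=> w /andP[_ /negPf->]; rewrite mul0r.
rewrite (eq_bigl (fun w => w \in fibre l u)) => [|w]; last first.
  by rewrite inE andb_idl // => /eqP/lm->; rewrite muv.
rewrite (eq_bigr (fun=> #|fibre l u|%:R^-1)); last first.
  by move=> w; rewrite inE => ->; rewrite mul1r.
by rewrite sumr_const -[LHS]mulr_natl divff ?fibre_card_neq0.
Qed.

(** The points of an [l]-fibre each carry the same average over that fibre, so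
    averaging over the points of an [m]-fibre weighs the [l]-fibres by their
    sizes. *)
Lemma fibre_avg_trans (T U : eqType) (l : G -> T) (m : G -> U) v :
  refines l m ->
  fibre_avg m v =
    #|fibre m v|%:R^-1 *: \sum_(u in fibre m v) fibre_avg l u.
Proof.
move=> lm; apply: value_at_inj => w.
rewrite value_at_fibre_avg /value_at mxE summxE mulrC; congr (_ * _).
rewrite -(fibre_sum_avg w v lm).
apply: eq_big => [u|u _]; first by rewrite inE.
rewrite -![(fibre_avg _ _) _ _]/(value_at _ _) !value_at_fibre_avg eq_sym.
by case: eqP => [e|_]; rewrite ?mul0r // /fibre e.
Qed.

(** Modulo the differences, all the [l]-averages in an [m]-fibre coincide, hence
    coincide with their own mean, which is the [m]-average.  This is the
    induction step for reaching the point masses from the constants. *)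
Lemma fibre_avg_step (T U : eqType) (l : G -> T) (m : G -> U)
    (W : {vspace 'rV[R]_#|G|}) v :
  refines l m -> {subset fibre_diffs l m <= W} ->
  fibre_avg m v \in W -> fibre_avg l v \in W.
Proof.
move=> lm sub mW.
suff d : fibre_avg l v - fibre_avg m v \in W.
  by rewrite -(subrK (fibre_avg m v) (fibre_avg l v)) memvD.
rewrite (fibre_avg_trans v lm).
have -> : fibre_avg l v
    = #|fibre m v|%:R^-1 *: \sum_(u in fibre m v) fibre_avg l v.
  by rewrite sumr_const -scaler_nat scalerA mulVf ?scale1r ?fibre_card_neq0.
rewrite -scalerBr -sumrB memvZ // memv_suml // => u; rewrite inE => /eqP mu.
by apply: sub; apply/fibre_diffsP; exists v, u.
Qed.

Lemma fibre_lap_const (T : eqType) (l : G -> T) f v :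
  (forall w, l w = l v -> value_at f w = value_at f v) -> fibre_lap l f v = 0.
Proof. by move=> cst; apply: big1 => w /eqP/cst->; rewrite subrr. Qed.

(** The difference is constant on the fibres of any finer labelling. *)
Lemma fibre_lap_diff_fine (S T : eqType) (k : G -> S) (l : G -> T) u v x :
  refines k l -> fibre_lap k (fibre_avg l u - fibre_avg l v) x = 0.
Proof.
move=> kl; apply: fibre_lap_const => w /kl e.
by rewrite !value_atB !value_at_fibre_avg e.
Qed.

(** The difference sums to zero on each [k]-fibre and vanishes outside that of
    [u], so only the term [f x], repeated over the fibre, survives. *)
Lemma fibre_lap_diff_coarse (S T : eqType) (k : G -> S) (l : G -> T) u v x :
  refines l k -> k u = k v ->
  fibre_lap k (fibre_avg l u - fibre_avg l v) x =
  #|fibre k u|%:R * value_at (fibre_avg l u - fibre_avg l v) x.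
Proof.
move=> lk kuv; set f := _ - _.
rewrite /fibre_lap big_split /= sumrN.
have -> : \sum_(w | k w == k x) value_at f w = 0.
  under eq_bigr => w _ do rewrite value_atB.
  by rewrite sumrB !(fibre_sum_avg _ x lk) kuv subrr.
rewrite subr0 sumr_const -[LHS]mulr_natl -cardsE -/(fibre k x).
have [e|ne] := eqVneq (k x) (k u).
  by rewrite /fibre e.
suff -> : value_at f x = 0 by rewrite !mulr0.
rewrite value_atB !value_at_fibre_avg.
have -> : (l x == l u) = false by apply: contraNF ne => /eqP/lk->.
have -> : (l x == l v) = false by apply: contraNF ne => /eqP/lk->; rewrite kuv.
by rewrite !mul0r subrr.
Qed.

End FibreAverages.

(** * Graphs made of cliques grouped into parts *)

Section CliquesInParts.
Variables (R : realFieldType) (G : sgraph) (S T : eqType).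
Variables (c : G -> S) (p : G -> T).
Hypothesis cp : refines c p.
Hypothesis adjE : forall u v : G,
  adj u v = (u != v) && ((c u == c v) || (p u != p v)).

Local Notation triv := (fun _ : G => tt).
Local Notation avg := (@fibre_avg R G _).
Local Notation L := (laplacian R G).

Definition clique_part_family : seq 'rV[R]_#|G| :=
  codom (avg triv : G -> 'rV[R]_#|G|) ++
  fibre_diffs R p triv ++ fibre_diffs R c p ++ fibre_diffs R id c.

Lemma span_clique_part_family : <<clique_part_family>>%VS = fullv.
Proof.
apply/eqP; rewrite eqEsubv subvf /=; set W := <<_>>%VS.
have sub X : {subset X <= clique_part_family} -> {subset X <= W}.
  by move=> sX f /sX; exact: memv_span.
have avgW v : avg id v \in W.
  apply: (@fibre_avg_step _ _ _ _ id c) => //; first by move=> x y ->.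
    by apply: sub => f fX; rewrite !mem_cat fX !orbT.
  apply: (@fibre_avg_step _ _ _ _ c p) => //.
    by apply: sub => f fX; rewrite !mem_cat fX !orbT.
  apply: (@fibre_avg_step _ _ _ _ p triv) => //.
    by apply: sub => f fX; rewrite !mem_cat fX !orbT.
  by apply: memv_span; rewrite mem_cat codom_f.
apply/subvP => f _.
(* The fibres of the identity are singletons: [avg id v] is a point mass. *)
have -> : f = \sum_v value_at f v *: avg id v.
  apply: value_at_inj => w; rewrite {2}/value_at summxE (bigD1 w) //= big1.
    rewrite addr0 mxE -[avg _ _ _ _]/(value_at _ w) value_at_fibre_avg eqxx.
    have -> : fibre id w = [set w] by apply/setP => z; rewrite !inE.
    by rewrite cards1 divr1 mulr1.
  move=> v vw; rewrite mxE -[avg _ _ _ _]/(value_at _ w) value_at_fibre_avg.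
  by rewrite eq_sym (negPf vw) mul0r mulr0.
by rewrite memv_suml // => v _; rewrite memvZ.
Qed.

(** Pairs in one clique are counted by all three operators on the right, pairs
    in one part but in different cliques by the last two, which cancel, and
    the other pairs by the last one only. *)
Lemma laplacian_fibre_lap (f : 'rV[R]_#|G|) v :
  \sum_(w | adj v w) (value_at f v - value_at f w)
    = fibre_lap c f v - fibre_lap p f v + fibre_lap triv f v.
Proof.
rewrite /fibre_lap !(big_mkcond _ (fun=> _ - _)) /= -sumrB -big_split /=.
apply: eq_bigr => w _; rewrite adjE.
have [<-|vw /=] := eqVneq v w; first by rewrite !subrr !if_same subr0 addr0.
rewrite (eq_sym (c w)) (eq_sym (p w)); have [/cp->|_] := eqVneq (c v) (c w).
  by rewrite eqxx /= subrr add0r.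
by case: eqP => _ /=; rewrite sub0r ?addNr ?oppr0 ?add0r.
Qed.

Lemma avg_triv_eigen v x :
  \sum_(w | adj x w) (value_at (avg triv v) x - value_at (avg triv v) w) = 0.
Proof. by apply: big1 => w _; rewrite !value_at_fibre_avg subrr. Qed.

Lemma vertex_diff_eigen u v x :
  c u = c v -> let f := avg id u - avg id v in
  \sum_(w | adj x w) (value_at f x - value_at f w) =
  (#|fibre c u|%:R - #|fibre p u|%:R + #|fibre triv u|%:R) * value_at f x.
Proof.
move=> cuv f; rewrite laplacian_fibre_lap.
have refid (U : eqType) (k : G -> U) : refines id k by move=> y z ->.
by rewrite !fibre_lap_diff_coarse ?(cp cuv) // mulrDl mulrBl.
Qed.

Lemma clique_diff_eigen u v x :
  p u = p v -> let f := avg c u - avg c v in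
  \sum_(w | adj x w) (value_at f x - value_at f w) =
  (#|fibre triv u|%:R - #|fibre p u|%:R) * value_at f x.
Proof.
move=> puv f; rewrite laplacian_fibre_lap fibre_lap_diff_fine //.
by rewrite !fibre_lap_diff_coarse // sub0r addrC mulrBl.
Qed.

Lemma part_diff_eigen u v x :
  let f := avg p u - avg p v in
  \sum_(w | adj x w) (value_at f x - value_at f w) = #|G|%:R * value_at f x.
Proof.
move=> f; rewrite laplacian_fibre_lap (@fibre_lap_diff_fine R G _ _ c p) //.
rewrite (@fibre_lap_diff_fine R G _ _ p p) // fibre_lap_diff_coarse //.
rewrite subrr add0r; congr (_%:R * _).
by apply: eq_card => w; rewrite !inE.
Qed.

Lemma clique_part_family_eigen f :
  f \in clique_part_family -> f != 0 -> exists a : R, is_eigenvector L a f.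
Proof.
rewrite !mem_cat => fX f0.
suff [a ha] : exists a : R, forall v,
    \sum_(w | adj v w) (value_at f v - value_at f w) = a * value_at f v.
  by exists a; apply/is_eigenvectorP.
case/or4P: fX => [/codomP[v ->]|/fibre_diffsP|/fibre_diffsP|/fibre_diffsP].
- by exists 0 => x; rewrite avg_triv_eigen mul0r.
- by move=> [u [v [_ ->]]]; eexists => x; exact: part_diff_eigen.
- by move=> [u [v [puv ->]]]; eexists => x; exact: clique_diff_eigen.
- by move=> [u [v [cuv ->]]]; eexists => x; exact: vertex_diff_eigen.
Qed.

Hypothesis other_part : forall v, exists w, p w != p v.

(** The negative set sits in a clique.  The nonnegative set contains [u] in the
    part of [v] and the whole of every other part, and vertices in different
    parts are adjacent: so two of its vertices in the same part have a common
    neighbour in it, namely [u], or any vertex outside the part of [v]. *)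
Lemma one_clique_nodal (f : G -> R) u v :
  0 < f u -> f v < 0 -> p u = p v ->
  (forall x, f x < 0 -> c x = c v) ->
  nodal_decomposition_is f 2.
Proof.
move=> fu fv puv neg; apply: (nodal_decomposition_eq2 fu fv); last first.
  apply/andP; split; first by apply/set0Pn; exists v; rewrite inE.
  apply/forall_inP => x xS; apply/forall_inP => y yS.
  have [<-|xy] := eqVneq x y; first exact: connect0.
  apply: connect1; rewrite /= xS yS adjE xy /=.
  by move: xS yS; rewrite !inE => /neg-> /neg->; rewrite eqxx.
set P := [set x | 0 <= f x].
have outP x : p x != p v -> x \in P.
  by rewrite inE leNgt; apply: contra => /neg/cp->.
have [w wv] := other_part v.
pose e := [rel a b : G | [&& a \in P, b \in P & adj a b]].
have cross x y : x \in P -> y \in P -> p x != p y -> connect e x y.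
  move=> xP yP pxy; apply: connect1; rewrite /= xP yP adjE pxy orbT andbT.
  by apply: contraNneq pxy => ->.
apply/andP; split; first by apply/set0Pn; exists u; rewrite inE ltW.
apply/forall_inP => x xP; apply/forall_inP => y yP.
have [pxy|/cross->//] := eqVneq (p x) (p y).
have uP : u \in P by rewrite inE ltW.
have [pxv|pxv] := eqVneq (p x) (p v).
  by apply: (@connect_trans _ _ w); apply: cross;
    rewrite ?(outP w) // -?pxy pxv // eq_sym.
by apply: (@connect_trans _ _ u); apply: cross; rewrite // -?pxy puv // eq_sym.
Qed.

(** This covers both the differences of vertices ([l] the identity) and of
    cliques ([l = c]). *)
Lemma fibre_diff_nodal (U : eqType) (l : G -> U) u v :
  refines l c -> p u = p v -> l u != l v ->
  nodal_decomposition_is (value_at (avg l u - avg l v)) 2.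
Proof.
move=> lc puv luv.
have pos x : 0 < #|fibre l x|%:R^-1 :> R.
  by rewrite invr_gt0 lt_def fibre_card_neq0 ler0n.
apply: (@one_clique_nodal _ u v) => // [||x];
  rewrite value_atB !value_at_fibre_avg ?eqxx ?(eq_sym (l v)) ?(negPf luv).
- by rewrite mul1r mul0r subr0.
- by rewrite mul1r mul0r sub0r oppr_lt0.
- have [/lc//|_] := eqVneq (l x) (l v); rewrite mul0r subr0.
  by case: eqP => _; rewrite ?mul1r ?mul0r ?ltxx // ltNge ltW.
Qed.

Lemma clique_part_family_nodal f (a : R) :
  f \in clique_part_family -> is_eigenvector L a f -> a != 0 ->
  ~ is_largest_eigenvalue L a -> nodal_decomposition_is (value_at f) 2.
Proof.
rewrite !mem_cat => fX eig a0 nmax; have [f0 _] := eig.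
have diff_neq0 (U : eqType) (l : G -> U) u v :
    f = avg l u - avg l v -> l u != l v.
  by move=> fE; apply: contraNneq f0 => /(eq_fibre_avg R) e; rewrite fE e subrr.
case/or4P: fX => [/codomP[v fE]|/fibre_diffsP|/fibre_diffsP|/fibre_diffsP].
- case/eqP: a0; apply: (eigenvector_value_inj eig); apply/is_eigenvectorP.
  by split=> // x; rewrite fE avg_triv_eigen mul0r.
- move=> [u [v [_ fE]]]; case: nmax.
  have -> : a = #|G|%:R.
    apply: (eigenvector_value_inj eig); apply/is_eigenvectorP.
    by split=> // x; rewrite fE part_diff_eigen.
  split; last exact: laplacian_eigenvalue_le.
  apply/eigenvalueP; exists f => //; suff [] : is_eigenvector L #|G|%:R f by [].
  by apply/is_eigenvectorP; split=> // x; rewrite fE part_diff_eigen.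
- move=> [u [v [puv fE]]]; have := diff_neq0 _ _ _ _ fE; rewrite fE.
  exact: fibre_diff_nodal.
- move=> [u [v [cuv fE]]]; have := diff_neq0 _ _ _ _ fE; rewrite fE.
  by apply: fibre_diff_nodal; [move=> x y ->|exact: cp].
Qed.

Lemma clique_part_basis :
  exists B : seq 'rV[R]_#|G|,
    [/\ basis_of fullv B,
        (forall f, f \in B -> exists a : R, is_eigenvector L a f) &
        (forall f (a : R), f \in B -> is_eigenvector L a f -> a != 0 ->
           ~ is_largest_eigenvalue L a ->
           nodal_decomposition_is (value_at f) 2)].
Proof.
have [B sB] := basis_sub_span clique_part_family.
rewrite span_clique_part_family => basB; exists B; split=> // f => [fB|a /sB].
  apply: clique_part_family_eigen (sB _ fB) _.
  by apply: (free_not0 (X := B)) => //; case/andP: basB.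
exact: clique_part_family_nodal.
Qed.

End CliquesInParts.

(** * The join of complete graphs over a complete multipartite graph *)

(** The clique of a vertex is the tag of its image in the join; its part is the
    block of that tag.  Nonempty cliques and at least two blocks provide
    vertices in different parts. *)
Lemma clique_join_labels (GG G : sgraph) (n : G -> nat) :
  complete_multipartite G -> (forall y, (1 <= n y)%N) ->
  graph_iso GG (graph_join (fun y : G => complete_graph (n y))) ->
  exists (c : GG -> G) (p : GG -> {set G}),
    [/\ refines c p,
        forall u v, adj u v = (u != v) && ((c u == c v) || (p u != p v)) &
        forall v, exists w, p w != p v].
Proof.
move=> [P [partP card_P indP adjP]] n_gt0 [phi phi_bij phi_adj].
have [psi phiK psiK] := phi_bij.
have [/eqP covP trivP _] := and3P partP.
have inP y : pblock P y \in P by apply: pblock_mem; rewrite covP.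
have in_pb y : y \in pblock P y by rewrite mem_pblock covP.
have adjG y z : adj y z = (pblock P y != pblock P z).
  have [e|ne] := eqVneq (pblock P y) (pblock P z).
    have yz : y \in pblock P z by rewrite -e.
    by apply/negbTE; apply: (indP _ (inP z)) => //.
  exact: (adjP _ _ (inP y) (inP z)).
exists (tag \o phi), (fun v => pblock P (tag (phi v))).
split=> [u v /= ->//|u v|v] /=.
  rewrite -phi_adj -(inj_eq (bij_inj phi_bij)) /= /join_adj adjG.
  case: (phi u) (phi v) => y i [z j] /=.
  have [e|ne] := eqVneq y z; last first.
    rewrite orbF andb_idl // => _.
    by apply: contraNneq ne => /(congr1 tag) /= ->.
  case: z / e j => j; rewrite eqxx /= andbT.
  rewrite [tagged_as _ _](tagged_as_fibre (F := fun y => complete_graph (n y))).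
  by rewrite /complete_adj eq_Tagged.
have [B BP neB] : exists2 B, B \in P & B != pblock P (tag (phi v)).
  have /subsetPn[B BP] : ~~ (P \subset [set pblock P (tag (phi v))]).
    by apply: contraTN card_P => /subset_leq_card; rewrite cards1 -ltnNge.
  by rewrite inE; exists B.
have [_ _ set0P] := and3P partP.
have /set0Pn[y yB] : B != set0 by apply: contraNneq set0P => <-.
exists (psi (existT _ y (Ordinal (n_gt0 y)))).
by rewrite psiK /= (def_pblock trivP BP yB).
Qed.

Theorem theorem2p10 (R : realType) (GG G : sgraph) (n : G -> nat)
    (hG : complete_multipartite G)
    (hn : forall y : G, (1 <= n y)%N)
    (hiso : graph_iso GG (graph_join (fun y : G => complete_graph (n y)))) :
  exists B : seq 'rV[R]_#|GG|,
    [/\ basis_of fullv B,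
        (forall f, f \in B ->
           exists lambda : R, is_eigenvector (laplacian R GG) lambda f) &
        (forall f (lambda : R), f \in B ->
           is_eigenvector (laplacian R GG) lambda f ->
           lambda != 0 ->
           ~ is_largest_eigenvalue (laplacian R GG) lambda ->
           nodal_decomposition_is (value_at f) 2)].
Proof.
have [c [p [cp adjE other_part]]] := clique_join_labels hG hn hiso.
exact: clique_part_basis cp adjE other_part.
Qed.
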